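(* There are sets $A\subseteq 2^\omega$ such that $2^\omega\setminus A$ is dense and the quantifier $Q_A$ is not definable in $\Sigma^1_1$, nor in $\Sigma^1_{1,\delta}$, nor in $L_{\omega_1\omega_1}$; that is, the class $K_A$ of all $\tau_d$-structures $\mathcal M$ such that $\Omega(\mathcal M)\setminus A$ is dense is not the class of models of any sentence of $\Sigma^1_1$, of $\Sigma^1_{1,\delta}$, or of $L_{\omega_1\omega_1}$.
   Context: Let $\tau_d=\{R_0,R_1,R_2,R_3,R_4\}$ with $R_0,R_1,R_2$ binary and $R_3,R_4$ unary. For $n<\omega$ and $\eta\in 2^n$ let $\psi_\eta(x)$ be the first-order formula $R_4(x)\wedge\exists y_0\ldots\exists y_n\big(R_3(y_0)\wedge R_4(y_n)\wedge\bigwedge_{i<n}R_{\eta(i)}(y_i,y_{i+1})\wedge\bigwedge_{i\le n}R_2(y_i,x)\big)$. For a $\tau_d$-structure $\mathcal M$ and $a\in M$ let $\Omega(\mathcal M,a)=\{\eta\in 2^{<\omega}:\mathcal M\models\psi_\eta(a)\}$ and $\Omega(\mathcal M)=\{\eta\in 2^\omega:\exists a\in M\ \forall n<\omega\ \eta\restriction n\in\Omega(\mathcal M,a)\}$. A set $B\subseteq 2^\omega$ is dense if every $s\in 2^{<\omega}$ has an extension in $B$. The quantifier $Q_A$ is the Lindström quantifier associated with the class $K_A$. $\Sigma^1_1$: sentences $\exists R_1\ldots\exists R_m\varphi$, $\varphi$ first-order; $\Sigma^1_{1,\delta}$: sentences $\exists R_1\ldots\exists R_m\bigwedge_{n<\omega}\varphi_n$,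 $\varphi_n$ first-order; $L_{\omega_1\omega_1}$ is infinitary logic with countable conjunctions/disjunctions and countable quantifier blocks. *)

(* Defs.v *)
From mathcomp Require Import all_boot.
From mathcomp Require Import boolp classical_sets.

Set Implicit Arguments.
Unset Strict Implicit.
Unset Printing Implicit Defensive.

Local Open Scope classical_set_scope.

(** * Relational vocabularies and structures *)

Record vocabulary := Vocabulary { rel_sym :> Type; arity : rel_sym -> nat }.

Record structure (L : vocabulary) := Structure {
  carrier :> Type;
  carrier_inhabited : inhabited carrier;
  interp : forall r : L, (arity r).-tuple carrier -> Prop }.

(** * First-order logic with equality

    The logical constants below are complete because satisfaction is
    classical. *)

Inductive fo (L : vocabulary) : Type :=
| FOtrue
| FOeq of nat & nat
| FOrel (r : L) of (arity r).-tuple nat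
| FOnot of fo L
| FOand of fo L & fo L
| FOex of nat & fo L.

Arguments FOtrue {L}.
Arguments FOeq {L} _ _.
Arguments FOrel {L} r _.

Definition FObigand L (phis : seq (fo L)) : fo L := foldr (@FOand L) FOtrue phis.

Definition FOexs L (xs : seq nat) (phi : fo L) : fo L := foldr (@FOex L) phi xs.

Fixpoint fo_sat L (M : structure L) (s : nat -> M) (phi : fo L) : Prop :=
  match phi with
  | FOtrue => True
  | FOeq x y => s x = s y
  | FOrel r xs => interp (map_tuple s xs)
  | FOnot phi1 => ~ fo_sat s phi1
  | FOand phi1 phi2 => fo_sat s phi1 /\ fo_sat s phi2
  | FOex x phi1 => exists a : M, fo_sat (fun y => if y == x then a else s y) phi1
  end.

Fixpoint fo_free L (v : nat) (phi : fo L) : bool :=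
  match phi with
  | FOtrue => false
  | FOeq x y => (v == x) || (v == y)
  | FOrel r xs => v \in xs
  | FOnot phi1 => fo_free v phi1
  | FOand phi1 phi2 => fo_free v phi1 || fo_free v phi2
  | FOex x phi1 => (v != x) && fo_free v phi1
  end.

Definition fo_sentence L (phi : fo L) : Prop := forall v, ~~ fo_free v phi.

Definition fo_models L (M : structure L) (phi : fo L) : Prop :=
  forall s : nat -> M, fo_sat s phi.

(** * Existential second-order classes *)

Definition expand_vocabulary (L : vocabulary) (m : nat) (k : 'I_m -> nat) :=
  @Vocabulary (L + 'I_m)%type
    (fun r => match r with inl r => arity r | inr j => k j end).

Definition expand_structure (L : vocabulary) (m : nat) (k : 'I_m -> nat)
    (M : structure L) (S : forall j, (k j).-tuple M -> Prop) :
    structure (expand_vocabulary L k) :=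
  @Structure (expand_vocabulary L k) M (carrier_inhabited M)
    (fun r => match r return (@arity (expand_vocabulary L k) r).-tuple M -> Prop with
              | inl r => @interp L M r
              | inr j => S j
              end).

Definition Sigma11_definable L (K : set (structure L)) : Prop :=
  exists (m : nat) (k : 'I_m -> nat) (phi : fo (expand_vocabulary L k)),
    fo_sentence phi /\
    forall M : structure L, K M <->
      exists S : forall j, (k j).-tuple M -> Prop,
        fo_models (expand_structure S) phi.

Definition Sigma11delta_definable L (K : set (structure L)) : Prop :=
  exists (m : nat) (k : 'I_m -> nat) (phi : nat -> fo (expand_vocabulary L k)),
    (forall n, fo_sentence (phi n)) /\
    forall M : structure L, K M <->
      exists S : forall j, (k j).-tuple M -> Prop,
        forall n, fo_models (expand_structure S) (phi n).

(** * The infinitary logic L_{omega_1 omega_1}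

    [V] is the supply of variables.  [Iex x phi] is the quantifier block
    "exists x_0 x_1 x_2 ..., phi"; the sequence [x] may have repetitions, so
    that shorter nonempty blocks are covered, and likewise for [Iand].
    Countable disjunctions and universal blocks are obtained by negation. *)

Inductive linf (L : vocabulary) (V : Type) : Type :=
| Ieq of V & V
| Irel (r : L) of (arity r).-tuple V
| Inot of linf L V
| Iand of (nat -> linf L V)
| Iex of (nat -> V) & linf L V.

Fixpoint linf_sat L V (M : structure L) (s : V -> M) (phi : linf L V) : Prop :=
  match phi with
  | Ieq x y => s x = s y
  | Irel r xs => interp (map_tuple s xs)
  | Inot phi1 => ~ linf_sat s phi1
  | Iand phis => forall n, linf_sat s (phis n)
  | Iex x phi1 => exists s' : V -> M,
      (forall v, ~ range x v -> s' v = s v) /\ linf_sat s' phi1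
  end.

Fixpoint linf_free L V (v : V) (phi : linf L V) : Prop :=
  match phi with
  | Ieq x y => v = x \/ v = y
  | Irel r xs => exists i, v = tnth xs i
  | Inot phi1 => linf_free v phi1
  | Iand phis => exists n, linf_free v (phis n)
  | Iex x phi1 => ~ range x v /\ linf_free v phi1
  end.

Definition linf_sentence L V (phi : linf L V) : Prop :=
  forall v, ~ linf_free v phi.

Definition linf_models L V (M : structure L) (phi : linf L V) : Prop :=
  forall s : V -> M, linf_sat s phi.

(* Any supply of variables may be used: the customary choice of aleph_1
   variables is one instance. *)
Definition Lomega1omega1_definable L (K : set (structure L)) : Prop :=
  exists (V : Type) (phi : linf L V),
    linf_sentence phi /\
    forall M : structure L, K M <-> linf_models M phi.

(** * The vocabulary tau_d and the classes K_A *)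

Inductive tau_d_sym := R0 | R1 | R2 | R3 | R4.

Definition tau_d : vocabulary :=
  @Vocabulary tau_d_sym
    (fun r => match r with R0 | R1 | R2 => 2 | R3 | R4 => 1 end).

(* Initial segment of length [n] of an infinite binary sequence. *)
Definition restr (eta : nat -> bool) (n : nat) : seq bool := mkseq eta n.

(* The element 0 of a binary sequence stands for the index of [R0] and 1 for
   that of [R1]. *)
Definition R_bit (b : bool) (u v : nat) : fo tau_d :=
  if b then @FOrel tau_d R1 [tuple u; v] else @FOrel tau_d R0 [tuple u; v].

(* The free variable x is variable 0, and y_i is variable i + 1. *)
Definition psi (eta : seq bool) : fo tau_d :=
  let n := size eta in
  let x := 0 in
  let y i := i.+1 in
  FOand (@FOrel tau_d R4 [tuple x])
    (FOexs [seq y i | i <- iota 0 n.+1]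
      (FOand (@FOrel tau_d R3 [tuple y 0])
      (FOand (@FOrel tau_d R4 [tuple y n])
      (FOand (FObigand [seq R_bit (nth false eta i) (y i) (y i.+1) | i <- iota 0 n])
             (FObigand [seq @FOrel tau_d R2 [tuple y i; x] | i <- iota 0 n.+1]))))).

(* Only variable 0 is free in [psi eta], so the constant assignment [a]
   expresses that [psi eta] holds at [a]. *)
Definition Omega_at (M : structure tau_d) (a : M) : set (seq bool) :=
  [set eta | fo_sat (fun=> a) (psi eta)].

Definition Omega (M : structure tau_d) : set (nat -> bool) :=
  [set eta | exists a : M, forall n, Omega_at a (restr eta n)].

Definition dense_seqs (B : set (nat -> bool)) : Prop :=
  forall s : seq bool, exists2 eta, B eta & restr eta (size s) = s.

Definition K_class (A : set (nat -> bool)) : set (structure tau_d) :=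
  [set M | dense_seqs (Omega M `\` A)].

(* Main.v *)
(* There are only continuum many sentences to rule out: those of the second-order
   logics use a countable vocabulary, and a formula of L_{omega_1 omega_1} is a
   countably branching well-founded tree mentioning countably many variables,
   which can be renamed to natural numbers.  So sentences [t] are coded
   injectively by reals [c t], chosen pairwise inequivalent modulo finite change.
   Any set of reals [B] is Omega(M_B) for some structure M_B.  With [E t] the set
   of finite modifications of [c t], which is dense, let [A] be the union of the
   [E t] such that M_{E t} satisfies [t].  As [A] contains or misses each [E t]
   entirely, M_{E t} is in K_A iff it does not satisfy [t]. *)
Require Import Defs.
From mathcomp Require Import all_boot.
From mathcomp Require Import boolp classical_sets cardinality.

Set Implicit Arguments.
Unset Strict Implicit.
Unset Printing Implicit Defensive.

Local Open Scope classical_set_scope.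

(** * First-order satisfaction *)

Lemma fo_sat_FOand (L : vocabulary) (M : structure L) (s : nat -> M) (phi psi : fo L) :
  fo_sat s (FOand phi psi) <-> fo_sat s phi /\ fo_sat s psi.
Proof. by []. Qed.

Lemma fo_sat_FOexs (L : vocabulary) (M : structure L) (xs : seq nat) (phi : fo L)
    (s : nat -> M) :
  fo_sat s (FOexs xs phi) <->
  exists s' : nat -> M, (forall v, v \notin xs -> s' v = s v) /\ fo_sat s' phi.
Proof.
elim: xs s => [|x xs IH] s /=.
  split=> [sat_phi|[s' [eq_s' sat_phi]]]; first by exists s.
  by suff -> : s = s' by []; apply/funext => v; rewrite eq_s'.
split=> [[a /IH[s' [eq_s' sat_phi]]]|[s' [eq_s' sat_phi]]].
  exists s'; split=> // v; rewrite inE negb_or => /andP[/negbTE vx vxs].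
  by rewrite eq_s' // vx.
exists (s' x); apply/IH; exists s'; split=> // v vxs.
by case: eqP => [->//|/eqP vx]; rewrite eq_s' // inE negb_or vx.
Qed.

Lemma fo_sat_FObigand_map (L : vocabulary) (M : structure L) (s : nat -> M)
    (f : nat -> fo L) (r : seq nat) :
  fo_sat s (FObigand [seq f i | i <- r]) <-> forall i, i \in r -> fo_sat s (f i).
Proof.
elim: r => [|i r IH] /=; first by split.
split=> [[sat_i /IH sat_r] j|sat_ir].
  by rewrite inE => /predU1P[->//|]; apply: sat_r.
split; first by apply: sat_ir; rewrite mem_head.
by apply/IH => j jr; apply: sat_ir; rewrite inE jr orbT.
Qed.

(** * Realizing a set of reals as Omega(M) *)

Section RealStructure.
Variable B : set (nat -> bool).

Definition real_interp (r : tau_d_sym) (t : seq ((nat -> bool) * nat)) : Prop :=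
  match r, t with
  | R0, [:: u; v] => [/\ u.1 = v.1, v.2 = u.2.+1 & u.1 u.2 = false]
  | R1, [:: u; v] => [/\ u.1 = v.1, v.2 = u.2.+1 & u.1 u.2 = true]
  | R2, [:: u; v] => u.1 = v.1
  | R3, [:: u] => u.2 = 0
  | R4, [:: u] => B u.1
  | _, _ => False
  end.

(* Each [xi] in [B] is laid out as a path (xi, 0), (xi, 1), ... whose edges are
   labelled by the bits of [xi]; [R2] relates the points of the same path. *)
Definition real_structure : structure tau_d :=
  @Structure tau_d ((nat -> bool) * nat) (inhabits (fun=> true, 0))
    (fun r t => real_interp r t).

Lemma fo_sat_R_bit (s : nat -> real_structure) (b : bool) (u v : nat) :
  fo_sat s (R_bit b u v) <->
  [/\ (s u).1 = (s v).1, (s v).2 = (s u).2.+1 & (s u).1 (s u).2 = b].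
Proof. by case: b. Qed.

(** [R2] keeps all witnesses on the path of [a], [R3] puts the first at position 0 and each edge
    advances by one; the witnesses are thus forced, and the edge labels spell the first bits of
    [a.1]. *)
Lemma Omega_at_real_structure (a : real_structure) (eta : seq bool) :
  Omega_at a eta <-> B a.1 /\ restr a.1 (size eta) = eta.
Proof.
rewrite /Omega_at /psi /mkset fo_sat_FOand fo_sat_FOexs; split.
  case=> Ba [s [s_out]]; rewrite 3!fo_sat_FOand.
  move=> [R3s [R4s [/fo_sat_FObigand_map path_s /fo_sat_FObigand_map R2s]]].
  split=> //.
  have s0 : s 0 = a by apply: s_out; apply/mapP => -[i].
  have s_fst i : i <= size eta -> (s i.+1).1 = a.1.
    move=> ile; rewrite -s0.
    exact: (R2s i (etrans (mem_iota 0 (size eta).+1 i) ile)).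
  have path_i i : i < size eta -> _ :=
    fun ilt => (fo_sat_R_bit s _ _ _).1 (path_s i (etrans (mem_iota 0 _ i) ilt)).
  have s_snd i : i <= size eta -> (s i.+1).2 = i.
    by elim: i => [//|i IH] ilt; have [_ -> _] := path_i i ilt; rewrite IH // ltnW.
  apply: (@eq_from_nth _ false); rewrite size_mkseq // => i ilt.
  rewrite nth_mkseq //; have [_ _ <-] := path_i i ilt.
  by rewrite s_snd ?(ltnW ilt) // s_fst // ltnW.
case=> Ba eq_eta; split=> //.
have bit_i i : i < size eta -> a.1 i = nth false eta i.
  by move=> ilt; rewrite -[in RHS]eq_eta nth_mkseq.
(* Variable [i.+1], standing for y_i, goes to position [i] on the path of [a]; all other variables
   keep the value [a]. *)
exists (fun v => if v is i.+1 then if i <= size eta then (a.1, i) else a else a).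
rewrite 3!fo_sat_FOand; split; last split=> //; last split.
- case=> [//|i]; rewrite mem_map; last exact: succn_inj.
  by rewrite mem_iota add0n ltnS /= => /negbTE ->.
- by rewrite /= /thead /tnth /= leqnn.
split; apply/fo_sat_FObigand_map => i; rewrite mem_iota /= add0n => ilt; last first.
  by rewrite /= -ltnS ilt.
by rewrite fo_sat_R_bit /= ilt (ltnW ilt); split=> //; apply: bit_i.
Qed.

Lemma Omega_real_structure : Omega real_structure = B.
Proof.
apply/seteqP; split=> [xi [a Omega_a]|xi B_xi].
  have [Ba _] := (Omega_at_real_structure _ _).1 (Omega_a 0).
  suff -> : xi = a.1 by [].
  apply/funext => n.
  have [_] := (Omega_at_real_structure _ _).1 (Omega_a n.+1).
  by move/(congr1 (nth false ^~ n)); rewrite size_mkseq !nth_mkseq.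
exists (xi, 0) => n; apply/Omega_at_real_structure; split=> //.
by rewrite size_mkseq.
Qed.

End RealStructure.

(** * Tail equivalence *)

Definition eqtail (eta xi : nat -> bool) : Prop :=
  exists N, forall n, N <= n -> eta n = xi n.

Lemma eqtail_refl (eta : nat -> bool) : eqtail eta eta.
Proof. by exists 0. Qed.

Lemma eqtail_sym (eta xi : nat -> bool) : eqtail eta xi -> eqtail xi eta.
Proof. by case=> N eq_N; exists N => n /eq_N. Qed.

Lemma eqtail_trans (eta xi zeta : nat -> bool) :
  eqtail eta xi -> eqtail xi zeta -> eqtail eta zeta.
Proof.
case=> N eq_N [N' eq_N']; exists (maxn N N') => n.
by rewrite geq_max => /andP[/eq_N -> /eq_N' ->].
Qed.

Lemma dense_eqtail (eta : nat -> bool) : dense_seqs [set xi | eqtail xi eta].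
Proof.
move=> s; exists (fun n => if n < size s then nth false s n else eta n).
  by exists (size s) => n; rewrite leqNgt => /negbTE ->.
apply: (@eq_from_nth _ false); rewrite size_mkseq // => i ilt.
by rewrite nth_mkseq // ilt.
Qed.

(* Every bit of [x] is repeated infinitely often, and so are infinitely many
   zeros, which keeps the image away from the class of the constant sequence 1. *)
Definition spread (x : nat -> bool) (n : nat) : bool :=
  if logn 2 n is m.+1 then x m else false.

Lemma logn2_cofinal (m N : nat) : exists2 n, N <= n & logn 2 n = m.
Proof.
(* An odd multiple of 2^m has 2-adic valuation exactly m. *)
exists (2 ^ m * N.*2.+1).
  apply: leq_trans (leq_pmull _ _); last by rewrite expn_gt0.
  by rewrite -addnn -addnS leq_addr.
rewrite lognM ?expn_gt0 // pfactorK // lognE.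
by rewrite /= dvdn2 /= odd_double addn0.
Qed.

Lemma eqtail_spread_inj (x y : nat -> bool) : eqtail (spread x) (spread y) -> x = y.
Proof.
case=> N eq_N; apply/funext => m.
have [n le_Nn log_n] := logn2_cofinal m.+1 N.
by have := eq_N n le_Nn; rewrite /spread log_n.
Qed.

Lemma spread_not_eqtail_true (x : nat -> bool) : ~ eqtail (fun=> true) (spread x).
Proof.
case=> N eq_N; have [n le_Nn log_n] := logn2_cofinal 0 N.
by have := eq_N n le_Nn; rewrite /spread log_n.
Qed.

(** * Diagonalization against injectively coded sentences *)

Lemma diagonal_K_class (T : Type) (code : T -> nat -> bool)
    (sem : T -> set (structure tau_d)) :
  injective code ->
  exists A : set (nat -> bool),
    dense_seqs (~` A) /\ forall t, ~ (forall M, K_class A M <-> sem t M).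
Proof.
move=> code_inj.
pose cls t := [set xi | eqtail xi (spread (code t))].
pose A := [set eta | exists2 t, eqtail eta (spread (code t))
                              & sem t (real_structure (cls t))].
exists A; split.
  (* [A] misses the tail class of the constant sequence 1, which is dense. *)
  move=> s; have [xi xi_true eq_s] := dense_eqtail (fun=> true) s; exists xi => //.
  move=> [t xi_t _]; apply: (@spread_not_eqtail_true (code t)).
  exact: eqtail_trans (eqtail_sym xi_true) xi_t.
move=> t /(_ (real_structure (cls t))).
(* Distinct codes have inequivalent spreads, so only [t] itself can put its class into [A]. *)
have cls_A : A (spread (code t)) <-> sem t (real_structure (cls t)).
  split=> [[u /eqtail_spread_inj/code_inj <-] //|sem_t].
  by exists t => //; apply: eqtail_refl.
rewrite -cls_A /K_class /mkset Omega_real_structure => -[dense_nA A_dense].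
have [spread_A|spread_nA] := pselect (A (spread (code t))).
  (* Here [A] contains the whole class of [t], so density fails already at the empty sequence. *)
  have [xi [xi_t]] := A_dense spread_A [::]; case.
  case: spread_A => u tu sem_u; exists u => //; exact: eqtail_trans tu.
(* Here [A] misses the whole class of [t], which is dense. *)
apply/spread_nA/dense_nA => s.
have [xi xi_t eq_s] := dense_eqtail (spread (code t)) s; exists xi => //.
split=> // -[u xi_u sem_u]; apply: spread_nA; exists u => //.
exact: eqtail_trans (eqtail_sym xi_t) xi_u.
Qed.

(** A labelling is determined by its graph, a subset of the countable set [P * L], and [code] is the
    characteristic function of that graph. *)
Lemma code_of_label (T : Type) (P L : countType) (label : T -> P -> L) :
  injective label -> exists code : T -> nat -> bool, injective code.
Proof.
move=> label_inj.
exists (fun t n => if unpickle n is Some (p, l) then label t p == l else false).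
move=> t u eq_tu; apply/label_inj/funext => p.
have := congr1 (@^~ (pickle (p, label t p))) eq_tu.
by rewrite pickleK eqxx => /esym/eqP.
Qed.

(** * Coding formulas *)

(** Generic trees over a countable type form a [countType], as labels must. Leaf tag 0 is kept for
    equality, whence the shift of [g r]. *)
Fixpoint fo_tree (L : vocabulary) (g : L -> nat) (phi : fo L) :
    GenTree.tree (nat * seq nat) :=
  match phi with
  | FOtrue => GenTree.Node 0 [::]
  | FOeq x y => GenTree.Leaf (0, [:: x; y])
  | FOrel r xs => GenTree.Leaf ((g r).+1, tval xs)
  | FOnot phi1 => GenTree.Node 1 [:: fo_tree g phi1]
  | FOand phi1 phi2 => GenTree.Node 2 [:: fo_tree g phi1; fo_tree g phi2]
  | FOex x phi1 => GenTree.Node 3 [:: GenTree.Leaf (x, [::]); fo_tree g phi1]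
  end.

Lemma fo_tree_inj (L : vocabulary) (g : L -> nat) :
  injective g -> injective (fo_tree g).
Proof.
move=> g_inj; elim=> [|x y|r xs|phi IH|phi1 IH1 phi2 IH2|x phi IH].
- by case.
- by case=> //= ? ? [-> ->].
- by case=> //= r' xs' [/g_inj eq_r]; move: xs'; rewrite -eq_r => xs' /val_inj ->.
- by case=> //= ? [/IH ->].
- by case=> //= ? ? [/IH1 -> /IH2 ->].
- by case=> //= ? ? [-> /IH ->].
Qed.

Definition tau_d_code (r : tau_d) : nat :=
  match r with R0 => 0 | R1 => 1 | R2 => 2 | R3 => 3 | R4 => 4 end.

Lemma tau_d_code_inj : injective tau_d_code. Proof. by case; case. Qed.

Definition expand_code (m : nat) (k : 'I_m -> nat) (r : expand_vocabulary tau_d k) :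
    nat :=
  match r with inl r => tau_d_code r | inr j => 5 + j end.

Lemma expand_code_inj (m : nat) (k : 'I_m -> nat) : injective (@expand_code m k).
Proof.
move=> [r|j] [r'|j'] /=.
- by move/tau_d_code_inj ->.
- by case: r.
- by case: r'.
- by move/addnI/val_inj ->.
Qed.

Definition Sigma11delta : Type :=
  {m : nat & {k : 'I_m -> nat & nat -> fo (expand_vocabulary tau_d k)}}.

Definition Sigma11delta_sat (t : Sigma11delta) : set (structure tau_d) :=
  [set M : structure tau_d | exists S : forall j, (projT1 (projT2 t) j).-tuple M -> Prop,
     forall n, fo_models (expand_structure S) (projT2 (projT2 t) n)].

Definition Sigma11delta_label (t : Sigma11delta) (n : nat) :
    seq nat * GenTree.tree (nat * seq nat) :=
  let: existT m (existT k phi) := t in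
  ([seq k j | j <- enum 'I_m], fo_tree (@expand_code m k) (phi n)).

Lemma Sigma11delta_label_inj : injective Sigma11delta_label.
Proof.
move=> [m [k phi]] [m' [k' phi']] eq_label.
have [eq_k _] := congr1 (@^~ 0) eq_label.
(* The arity list yields [m] by its length and then [k]; only then do the two sequences of formulas
   have the same type. *)
have eq_m : m = m' by have := congr1 size eq_k; rewrite 2!size_map 2!size_enum_ord.
subst m'.
have {}eq_k : k = k'.
  by apply/funext => j; move/eq_in_map: eq_k; apply; rewrite mem_enum.
subst k'; suff -> : phi = phi' by []; apply/funext => n.
by have [/fo_tree_inj] := congr1 (@^~ n) eq_label; apply; apply: expand_code_inj.
Qed.

(* [p] is a position in the syntax tree; below [Iex x phi1], child 0 is the body
   and child [n.+1] records the variable [x n]. *)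
Fixpoint linf_label (L : vocabulary) (g : L -> nat) (phi : linf L nat)
    (p : seq nat) : nat * seq nat :=
  match phi, p with
  | Ieq x y, _ => (0, [:: x; y])
  | Irel r xs, _ => (1, g r :: xs)
  | Inot phi1, [::] => (2, [::])
  | Inot phi1, _ :: q => linf_label g phi1 q
  | Iand phis, [::] => (3, [::])
  | Iand phis, n :: q => linf_label g (phis n) q
  | Iex x phi1, [::] => (4, [::])
  | Iex x phi1, 0 :: q => linf_label g phi1 q
  | Iex x phi1, n.+1 :: _ => (5, [:: x n])
  end.

(** The root label reveals the constructor, and the labels below a child are those of the
    subformula, so induction applies. *)
Lemma linf_label_inj (L : vocabulary) (g : L -> nat) :
  injective g -> injective (linf_label g).
Proof.
move=> g_inj; elim=> [x y|r xs|phi IH|phis IH|x phi IH] psi eq_label.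
- have := congr1 (@^~ [::]) eq_label.
  by case: psi {eq_label} => //= ? ? [-> ->].
- have := congr1 (@^~ [::]) eq_label.
  case: psi {eq_label} => //= r' xs' [/g_inj eq_r].
  by move: xs'; rewrite -eq_r => xs' /val_inj ->.
- have := congr1 (@^~ [::]) eq_label; case: psi eq_label => //= psi eq_label _.
  congr Inot; apply: IH; apply/funext => q.
  exact: (congr1 (@^~ (0 :: q)) eq_label).
- have := congr1 (@^~ [::]) eq_label; case: psi eq_label => //= psis eq_label _.
  congr Iand; apply/funext => n; apply: IH; apply/funext => q.
  exact: (congr1 (@^~ (n :: q)) eq_label).
- have := congr1 (@^~ [::]) eq_label; case: psi eq_label => //= y psi eq_label _.
  congr Iex.
    by apply/funext => n; case: (congr1 (@^~ [:: n.+1]) eq_label).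
  apply: IH; apply/funext => q; exact: (congr1 (@^~ (0 :: q)) eq_label).
Qed.

(** * Renaming the variables of an infinitary formula *)

(** Bound variables are included, so that a renaming injective on this set captures no variable. *)
Fixpoint linf_vars (L : vocabulary) (V : Type) (phi : linf L V) : set V :=
  match phi with
  | Ieq x y => [set x; y]
  | Irel r xs => range (tnth xs)
  | Inot phi1 => linf_vars phi1
  | Iand phis => \bigcup_n linf_vars (phis n)
  | Iex x phi1 => range x `|` linf_vars phi1
  end.

Lemma countable_linf_vars (L : vocabulary) (V : Type) (phi : linf L V) :
  countable (linf_vars phi).
Proof.
have countable_range (I : countType) (f : I -> V) : countable (range f).
  exact: sub_countable (card_image_le _ _) _.
elim: phi => [x y|r xs|phi IH|phis IH|x phi IH] //=.
- exact: finite_set_countable.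
- by apply: bigcup_countable => // n _; apply: IH.
- rewrite -bigcup2E; apply: bigcup_countable => // n _.
  by case: n => [|[|n]] /=; [apply: countable_range | | apply: countable0].
Qed.

Fixpoint linf_rename (L : vocabulary) (V W : Type) (r : V -> W) (phi : linf L V) :
    linf L W :=
  match phi with
  | Ieq x y => Ieq L (r x) (r y)
  | Irel R xs => Irel (map_tuple r xs)
  | Inot phi1 => Inot (linf_rename r phi1)
  | Iand phis => Iand (fun n => linf_rename r (phis n))
  | Iex x phi1 => Iex (r \o x) (linf_rename r phi1)
  end.

Section Rename.
Variables (L : vocabulary) (V W : Type) (r : V -> W) (D : set V).
Hypothesis r_inj : {in D &, injective r}.

(** Injectivity on [D] makes the transported values well defined. Prescribing [u] off the image
    serves the quantifier case, where only the quantified variables may change. *)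
Lemma transport_assignment (M : Type) (t : V -> M) (u : W -> M) :
  exists u' : W -> M,
    (forall v, D v -> u' (r v) = t v) /\ forall w, ~ (r @` D) w -> u' w = u w.
Proof.
have /choice[u' u'P] : forall w, exists a : M,
    (forall v, D v -> r v = w -> a = t v) /\ (~ (r @` D) w -> a = u w).
  move=> w; have [[v Dv <-]|nw] := pselect ((r @` D) w).
    exists (t v); split=> [v' Dv' rv|[]]; last by exists v.
    by congr t; apply: r_inj; rewrite ?inE.
  by exists (u w); split=> // v Dv rv; case: nw; exists v.
by exists u'; split=> [v Dv|w]; [apply: (u'P _).1 | apply: (u'P w).2].
Qed.

Lemma linf_sat_rename (M : structure L) (phi : linf L V) (s : V -> M) (s' : W -> M) :
  linf_vars phi `<=` D -> (forall v, D v -> s' (r v) = s v) ->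
  linf_sat s' (linf_rename r phi) <-> linf_sat s phi.
Proof.
elim: phi s s' => [x y|R xs|phi IH|phis IH|x phi IH] s s' /= sub_D eq_s.
- by rewrite !eq_s //; apply: sub_D; [right|left].
- suff -> : map_tuple s' (map_tuple r xs) = map_tuple s xs by [].
  apply: eq_from_tnth => i; rewrite !tnth_map eq_s //.
  by apply: sub_D; exists i.
- by rewrite (IH s s').
- split=> sat n; apply/(IH n s s'); rewrite ?sat // => v phi_v;
    by apply: sub_D; exists n.
- have D_x n : D (x n) by apply: sub_D; left; exists n.
  have sub_phi : linf_vars phi `<=` D by move=> v ?; apply: sub_D; right.
  split=> [[t' [eq_t' sat_phi]]|[t [eq_t sat_phi]]].
    (* Pull [t'] back along [r] on [D]; outside [D], which contains the block [x], the assignment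
       must stay [s]. *)
    exists (fun v => if pselect (D v) is left _ then t' (r v) else s v); split.
      move=> v nxv; case: pselect => // Dv; rewrite eq_t' ?eq_s // => -[n _ /= rxv].
      by apply: nxv; exists n => //; apply: r_inj; rewrite ?inE.
    by apply: (iffLR (IH _ t' sub_phi _) sat_phi) => v Dv; case: pselect.
  have [t' [eq_t' out_t']] := transport_assignment t s'.
  exists t'; split; last exact: (iffRL (IH t t' sub_phi eq_t')).
  move=> w nxw; have [[v Dv rv]|nw] := pselect ((r @` D) w); last exact: out_t'.
  rewrite -rv eq_t' // eq_s // eq_t // => -[n _ xn]; apply: nxw.
  by exists n => //=; rewrite xn.
Qed.

Lemma linf_models_rename (M : structure L) (phi : linf L V) :
  linf_vars phi `<=` D ->
  linf_models M (linf_rename r phi) <-> linf_models M phi.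
Proof.
move=> sub_D; split=> models s; last first.
  exact/(@linf_sat_rename _ _ (s \o r) s).
(* The inhabitant [a] serves as default value off the image of [D]. *)
have [a] := carrier_inhabited M.
have [s' [eq_s _]] := transport_assignment s (fun=> a).
exact/(@linf_sat_rename _ _ s s').
Qed.

End Rename.

Theorem theorem14 :
  exists A : set (nat -> bool),
    dense_seqs (~` A) /\
    ~ Sigma11_definable (K_class A) /\
    ~ Sigma11delta_definable (K_class A) /\
    ~ Lomega1omega1_definable (K_class A).
Proof.
(* One [A] must defeat all the logics at once, hence a sum type with a common type of positions. *)
pose label (t : Sigma11delta + linf tau_d nat) (p : seq nat) :=
  match t with
  | inl t => inl (Sigma11delta_label t (head 0 p))
  | inr phi => inr (linf_label tau_d_code phi p)
  end.
have /code_of_label[code code_inj] : injective label.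
  move=> [t|phi] [u|psi] eq_label.
  - congr inl; apply/Sigma11delta_label_inj/funext => n.
    by case: (congr1 (@^~ [:: n]) eq_label).
  - by have := congr1 (@^~ [::]) eq_label.
  - by have := congr1 (@^~ [::]) eq_label.
  - congr inr; apply/(linf_label_inj tau_d_code_inj)/funext => p.
    by case: (congr1 (@^~ p) eq_label).
pose sem (t : Sigma11delta + linf tau_d nat) : set (structure tau_d) :=
  match t with
  | inl t => Sigma11delta_sat t
  | inr phi => [set M | linf_models M phi]
  end.
have [A [nA_dense not_sem]] := diagonal_K_class sem code_inj.
exists A; split=> //; split; [|split].
- case=> m [k [phi [_ def_K]]].
  (* A single first-order formula is treated as a constant sequence. *)
  apply: (not_sem (inl (existT _ m (existT _ k (fun=> phi))))) => M.
  rewrite def_K; split=> -[S sat]; exists S => //; exact: (sat 0).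
- case=> m [k [phi [_ def_K]]].
  exact: (not_sem (inl (existT _ m (existT _ k phi)))).
- case=> V [phi [_ def_K]].
  (* Countably many variables occur in [phi], so they can be renamed injectively to natural
     numbers. *)
  have /countable_injP[r r_inj] := countable_linf_vars phi.
  apply: (not_sem (inr (linf_rename r phi))) => M.
  by rewrite def_K /= (linf_models_rename r_inj).
Qed.
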